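(* Let $f:\mathbb{R}^n\to\mathbb{R}^n$ be a polynomial vector field, $\lambda>0$, $\beta\in\mathbb{N}$, $R>0$ and $\Lambda\subset\mathbb{R}^n$. Suppose $ROA_f\subseteq B_R(0)$ and there exists $\eta>0$ such that $B_\eta(0)$ is an exponentially stable set of the ODE $\dot x=f(x)$. Then $$\{x\in B_R(0):P_d(x)<1\}\subseteq ROA_f\quad\text{for all }d\in\mathbb{N},$$ where $P_d$ is any solution (minimizer $J$) of the degree-$d$ SOS optimization problem defined in the context, with data $f,\lambda,\beta,R,\Lambda$.
   Context: Standing assumptions: $f(0)=0$, and the ODE $\dot x(t)=f(x(t))$, $x(0)=x_0$, has a unique solution map $\phi_f(x,t)$ defined for all $(x,t)\in\mathbb{R}^n\times[0,\infty)$, i.e. $\frac{\partial}{\partial t}\phi_f(x,t)=f(\phi_f(x,t))$, $\phi_f(x,0)=x$, and $\phi_f(\phi_f(x,t),s)=\phi_f(x,t+s)$. $B_r(y)=\{x\in\mathbb{R}^n:\|x-y\|_2<r\}$. $\beta$ and $d$ are positive integers. Region of attraction: $ROA_f=\{x\in\mathbb{R}^n:\lim_{t\to\infty}\|\phi_f(x,t)\|_2=0\}$. Exponentially stable set: a set $U\subset\mathbb{R}^n$ that contains a neighborhood of the origin and for which there exist $\delta,\mu>0$ such that for every $x\in U$: $\phi_f(x,t)\in U$ for all $t\ge0$, $\lim_{t\to\infty}\phi_f(x,t)=0$, and $\|\phi_f(x,t)\|_2\le\mu e^{-\delta t}\|x\|_2$ for all $t\ge0$. $\mathcal P_d$ denotes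 real polynomials on $\mathbb{R}^n$ of degree at most $d$; $\Sigma_{SOS}^d$ denotes sum-of-squares polynomials of degree at most $d$ (a polynomial is SOS if it is a finite sum of squares of real polynomials). Degree-$d$ SOS optimization problem: minimize $\int_\Lambda J(x)\,dx$ over $J\in\mathcal P_d$ (equivalently minimize $c^T\alpha$ where $J=c^TZ_d$, $Z_d$ is the vector of monomials of degree at most $d$ and $\alpha_i=\int_\Lambda Z_{d,i}(x)\,dx$), subject to the existence of $k_1,k_2,s\in\Sigma_{SOS}^d$ and $p\in\mathcal P_d$ such that, as polynomial identities in $x$, $$J(0)\ge0,$$ $$k_1(x)=-\nabla J(x)^Tf(x)-\lambda(1-J(x))\|x\|_2^{2\beta}-s(x)(R^2-\|x\|_2^2),$$ $$k_2(x)=(J(x)-1)-p(x)(R^2-\|x\|_2^2).$$ *)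

(* Defs.v *)
From HB Require Import structures.
From mathcomp Require Import all_boot all_order all_algebra.
From mathcomp Require Import all_classical all_reals all_analysis.
From mathcomp Require mpoly.
Import (canonicals, coercions) mpoly.

Set Implicit Arguments.
Unset Strict Implicit.
Unset Printing Implicit Defensive.

Import Order.TTheory GRing.Theory Num.Theory.
Import numFieldNormedType.Exports.

Local Open Scope classical_set_scope.
Local Open Scope ring_scope.

Section lebesgue_measure_step.
Context (R : realType) (n : nat).
Variable mu : {sigma_finite_measure set (n.-tuple (measurableTypeR R)) -> \bar R}.

Let T := measurableTypeR R.

Definition tuple_cons (z : T * n.-tuple T) : n.+1.-tuple T :=
  [tuple of z.1 :: z.2].

Definition cons_measure : set (n.+1.-tuple T) -> \bar R :=
  pushforward (@lebesgue_measure R \x mu)%E tuple_cons.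

Lemma measurable_tuple_cons : measurable_fun setT tuple_cons.
Proof. exact: measurable_cons. Qed.

Let cons_measure0 : cons_measure set0 = 0%E.
Proof. by rewrite /cons_measure /pushforward preimage_set0 measure0. Qed.

Let cons_measure_ge0 A : (0 <= cons_measure A)%E.
Proof. by rewrite /cons_measure /pushforward measure_ge0. Qed.

Let cons_measure_sigma_additive : semi_sigma_additive cons_measure.
Proof.
move=> F mF tF mUF; rewrite /cons_measure /pushforward preimage_bigcup.
apply: measure_semi_sigma_additive.
- by move=> k; rewrite -[X in measurable X]setTI; exact: measurable_tuple_cons.
- apply/trivIsetP => /= i j _ _ ij; rewrite -preimage_setI.
  by move/trivIsetP : tF => /(_ _ _ _ _ ij) ->//; rewrite preimage_set0.
- by rewrite -preimage_bigcup -[X in measurable X]setTI;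
    exact: measurable_tuple_cons.
Qed.

HB.instance Definition _ := isMeasure.Build _ _ _ cons_measure
  cons_measure0 cons_measure_ge0 cons_measure_sigma_additive.

Let cons_measure_sigma_finite : sigma_finite setT cons_measure.
Proof.
have /sigma_finiteP[F [TF ndF Foo]] := sigma_finiteT (@lebesgue_measure R).
have /sigma_finiteP[G [TG ndG Goo]] := sigma_finiteT mu.
exists (fun k => [set u | F k (thead u) /\ G k [tuple of behead u]]).
  rewrite predeqE => u; split=> // _.
  have : setT (thead u) by [].
  rewrite TF => -[i _ Fi].
  have : setT [tuple of behead u] by [].
  rewrite TG => -[j _ Gj].
  exists (maxn i j) => //; split.
    by move: Fi; exact/subsetPset/ndF/leq_maxl.
  by move: Gj; exact/subsetPset/ndG/leq_maxr.
move=> k; have [mF Fk] := Foo k; have [mG Gk] := Goo k; split.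
  apply: measurableI.
    rewrite -[X in measurable X]setTI.
    exact: (measurable_tnth ord0).
  rewrite -[X in measurable X]setTI.
  exact: measurable_behead.
rewrite /cons_measure /pushforward.
have -> : tuple_cons @^-1` [set u | F k (thead u) /\ G k [tuple of behead u]]
    = F k `*` G k.
  apply/seteqP; split=> -[x t] /=; rewrite theadE;
  have -> // : [tuple of behead (tuple_cons (x, t))] = t by apply/val_inj.
by rewrite product_measure1E// lte_mul_pinfty// ge0_fin_numE.
Qed.

HB.instance Definition _ := Measure_isSigmaFinite.Build _ _ _ cons_measure
  cons_measure_sigma_finite.

End lebesgue_measure_step.

(* Lebesgue measure on R^n: the n-fold product of the one-dimensional one. *)
Fixpoint lebesgue_tuple (R : realType) (n : nat) :
    {sigma_finite_measure set (n.-tuple (measurableTypeR R)) -> \bar R} :=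
  match n with
  | 0%N => \d_ [tuple]
  | m.+1 => cons_measure (lebesgue_tuple R m)
  end.

(* Points of R^n are row vectors; n-tuples only carry the measure, and the
   tuple u is identified with the row vector of its entries. The integral is
   total: it is the Lebesgue integral, as an extended real, whenever D is
   Lebesgue measurable, g is a polynomial and its positive or its negative
   part is integrable on D. *)
Definition Rn_integral (R : realType) (n : nat) (D : set 'rV[R]_n)
    (g : 'rV[R]_n -> R) : \bar R :=
  let rV_of (u : n.-tuple (measurableTypeR R)) : 'rV[R]_n :=
    \row_i (tnth u i : R) in
  (\int[lebesgue_tuple R n]_(u in rV_of @^-1` D) (g (rV_of u))%:E)%E.

Local Notation "{ 'mpoly' T [ n ] }" := (mpoly.mpoly n T).

Section dynamics.
Context (R : realType) (n : nat).
Implicit Types (f : 'I_n -> {mpoly R[n]}) (phi : 'rV[R]_n -> R -> 'rV[R]_n).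

(* Euclidean norm; the norm `|x| on matrices is the max norm. *)
Definition norm2 (x : 'rV[R]_n) : R := Num.sqrt (\sum_(i < n) x ord0 i ^+ 2).

Definition ball2 (y : 'rV[R]_n) (r : R) : set 'rV[R]_n :=
  [set x | norm2 (x - y) < r].

Definition peval (p : {mpoly R[n]}) (x : 'rV[R]_n) : R :=
  mpoly.meval (x ord0) p.

Definition vector_field f (x : 'rV[R]_n) : 'rV[R]_n := \row_i peval (f i) x.

(* Derivatives are relative to the time domain [0, +oo[, hence two-sided for
   0 < t and one-sided at t = 0; values at negative times play no role. *)
Definition ode_solution f (y : R -> 'rV[R]_n) :=
  forall t : R, 0 <= t ->
    h^-1 *: (y (t + h) - y t) @[h --> within [set h | 0 <= t + h] 0^']
      --> vector_field f (y t).

Definition solution_map f phi :=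
  [/\ forall x, ode_solution f (phi x),
      forall x, phi x 0 = x,
      forall x (t s : R), 0 <= t -> 0 <= s -> phi (phi x t) s = phi x (t + s) &
      forall x y, ode_solution f y -> y 0 = x ->
        forall t : R, 0 <= t -> y t = phi x t].

Definition ROA phi : set 'rV[R]_n :=
  [set x | norm2 (phi x t) @[t --> +oo] --> (0 : R)].

Definition exponentially_stable_set phi (U : set 'rV[R]_n) :=
  nbhs (0 : 'rV[R]_n) U /\
  exists delta mu : R, [/\ 0 < delta, 0 < mu &
    forall x, U x ->
      [/\ forall t : R, 0 <= t -> U (phi x t),
          phi x t @[t --> +oo] --> (0 : 'rV[R]_n) &
          forall t : R, 0 <= t ->
            norm2 (phi x t) <= mu * expR (- delta * t) * norm2 x]].

End dynamics.

Section sos_problem.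
Context (R : realType) (n : nat).
Implicit Types (f : 'I_n -> {mpoly R[n]}) (p J : {mpoly R[n]}).

(* msize is the total degree plus one, and 0 for the zero polynomial. *)
Definition deg_le (d : nat) p := (mpoly.msize p <= d.+1)%N.

Definition is_sos p := exists qs : seq {mpoly R[n]}, p = \sum_(q <- qs) q ^+ 2.

Definition sos_deg_le (d : nat) p := is_sos p /\ deg_le d p.

Definition sqnorm_poly : {mpoly R[n]} :=
  \sum_(i < n) mpoly.mpolyX R (mpoly.mnm1 i) ^+ 2.

Definition lie_derivative J f : {mpoly R[n]} :=
  \sum_(i < n) mpoly.mderiv i J * f i.

Definition sos_feasible f (lambda : R) (beta : nat) (r : R) (d : nat) J :=
  deg_le d J /\
  exists k1 k2 s p : {mpoly R[n]},
    [/\ sos_deg_le d k1, sos_deg_le d k2, sos_deg_le d s & deg_le d p] /\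
    [/\ 0 <= peval J 0,
        k1 = - lie_derivative J f
             - lambda *: ((1 - J) * sqnorm_poly ^+ beta)
             - s * (mpoly.mpolyC n (r ^+ 2) - sqnorm_poly) &
        k2 = (J - 1) - p * (mpoly.mpolyC n (r ^+ 2) - sqnorm_poly)].

Definition sos_minimizer f (lambda : R) (beta : nat) (r : R)
    (Lambda : set 'rV[R]_n) (d : nat) J :=
  sos_feasible f lambda beta r d J /\
  forall J', sos_feasible f lambda beta r d J' ->
    (Rn_integral Lambda (peval J) <= Rn_integral Lambda (peval J'))%E.

End sos_problem.

(* Main.v *)
Require Import Defs.
From mathcomp Require Import all_boot all_order all_algebra.
From mathcomp Require Import all_classical all_reals all_analysis.
From mathcomp Require mpoly.
Import (canonicals, coercions) mpoly.
From mathcomp Require Import ring lra.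

Import Order.TTheory GRing.Theory Num.Theory.
Import numFieldNormedType.Exports.

Local Open Scope classical_set_scope.
Local Open Scope ring_scope.

(** A feasible P is a Lyapunov function in disguise: follow
    w(t) = 1 - P(phi(x, t)) along a trajectory. Evaluating the two
    sum-of-squares identities pointwise gives
    - on the closed ball of radius r, the derivative of w is at least
      lambda * w * |phi|^(2 beta) (lemma [sos_feasible_lie]);
    - on the sphere of radius r, w <= 0 ([sos_feasible_sphere]).

    Start in the open ball with w(0) > 0. As long as the trajectory is in the
    ball and w >= 0, w does not decrease; so at a first exit time w would still
    be positive, yet at such a time either w <= 0 or the trajectory is on the
    sphere, where w <= 0 again. Hence it never leaves, and w(t) >= w(0) for all
    t ([first_exit_barrier]).

    If the trajectory moreover avoided the exponentially stable ball of radius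
    eta forever, the derivative of w would be bounded below by the positive
    constant lambda * w(0) * eta^(2 beta), so w would grow at least linearly;
    but a polynomial is bounded on a ball ([peval_bounded_ball]). So the
    trajectory enters the stable ball, and from then on it decays to the origin
    ([ROA_of_enter_stable]).

    Solutions are differentiable only one-sidedly at time 0; this is why the
    real functions below are assumed continuous within [0, +oo[ and
    differentiable at positive times only, which is all that the mean value
    theorem asks for. *)

(** * Monotonicity and first exit times for real functions *)

Section real_functions.
Context {R : realType}.
Implicit Types (w S dw : R -> R) (t : R).

Lemma within_continuous_segment w (a b : R) : 0 <= a ->
  {within `[0, +oo[, continuous w} -> {within `[a, b], continuous w}.
Proof.
move=> a0; apply: continuous_subspaceW => t /=.
by rewrite !in_itv/= andbT => /andP[at_ _]; exact: le_trans at_.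
Qed.

Lemma le_of_derive_ge w dw (a b c : R) : 0 <= a -> a <= b ->
  {within `[0, +oo[, continuous w} ->
  (forall t, 0 < t -> is_derive t 1 w (dw t)) ->
  (forall t, a < t < b -> c <= dw t) ->
  c * (b - a) <= w b - w a.
Proof.
move=> a0; rewrite le_eqVlt => /predU1P[<-|ab] cw dwE cdw.
  by rewrite !subrr mulr0.
have [t| |t tab ->] := @MVT _ w dw a b ab; last 1 first.
- rewrite in_itv in tab; apply: ler_wpM2r; last exact: cdw.
  by rewrite subr_ge0 ltW.
- by rewrite in_itv/= => /andP[at_ _]; apply: dwE; exact: le_lt_trans at_.
- exact: within_continuous_segment.
Qed.

Lemma nondecreasing_of_derive_ge0 w dw (a b : R) : 0 <= a -> a <= b ->
  {within `[0, +oo[, continuous w} ->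
  (forall t, 0 < t -> is_derive t 1 w (dw t)) ->
  (forall t, a < t < b -> 0 <= dw t) ->
  w a <= w b.
Proof.
move=> a0 ab cw dwE dw_ge0.
have := le_of_derive_ge w dw a b 0 a0 ab cw dwE dw_ge0.
by rewrite mul0r subr_ge0.
Qed.

(** At the first time T at which [S] reaches [rho] or [w] loses positivity,
    monotonicity on [0, T] gives w T >= w 0 > 0, and continuity of [S] gives
    S T <= rho; so S T = rho, where [w] is supposed to be nonpositive. *)
Lemma first_exit_barrier w S dw (rho : R) :
  {within `[0, +oo[, continuous w} -> {within `[0, +oo[, continuous S} ->
  (forall t, 0 < t -> is_derive t 1 w (dw t)) ->
  (forall t, 0 < t -> S t <= rho -> 0 <= w t -> 0 <= dw t) ->
  (forall t, 0 <= t -> S t = rho -> w t <= 0) ->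
  0 < w 0 -> S 0 < rho ->
  forall t, 0 <= t -> S t < rho /\ w 0 <= w t.
Proof.
move=> cw cS dwE dw_ge0 w_le0 w0 S0.
pose bad := [set t : R | 0 <= t /\ (rho <= S t \/ w t <= 0)].
have good t : 0 <= t -> ~ bad t -> S t < rho /\ 0 < w t.
  move=> t0 nbad; split; rewrite ltNge; apply/negP => h; apply: nbad.
    by split=> //; left.
  by split=> //; right.
suff nobad t : 0 <= t -> ~ bad t.
  move=> t t0; have [St wt] := good t t0 (nobad t t0); split=> //.
  apply: (nondecreasing_of_derive_ge0 w dw) => // u /andP[u0 ut].
  have [Su wu] := good u (ltW u0) (nobad u (ltW u0)).
  by apply: dw_ge0 => //; exact: ltW.
move=> t0 badt.
have hinf : has_inf bad.
  by split; [exists t | exists 0 => ? []].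
pose T := inf bad.
have T0 : 0 <= T by apply: lb_le_inf; [exists t | move=> ? []].
have goodlt u : 0 <= u -> u < T -> S u < rho /\ 0 < w u.
  move=> u0 uT; apply: good => // badu.
  by move: uT; rewrite ltNge => /negP; apply; apply: ge_inf => //; case: hinf.
have near0 (g : R -> R) : {within `[0, +oo[, continuous g} ->
    g s @[s --> within `[0, +oo[ (nbhs T)] --> g T.
  by move=> /subspace_continuousP; apply; rewrite /= in_itv/= andbT.
(* Otherwise the good behaviour would persist on a right neighbourhood of T,
   although elements of bad come arbitrarily close to their infimum. *)
have badT : bad T.
  apply: contrapT => /(good _ T0)[ST wT].
  have [e /= e0 He] : \forall s \near T, s \in `[0, +oo[ -> S s < rho /\ 0 < w s.
    have nS : \forall s \near within `[0, +oo[ (nbhs T), S s < rho.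
      exact: (near0 _ cS _ (lt_nbhsl ST)).
    have nw : \forall s \near within `[0, +oo[ (nbhs T), 0 < w s.
      exact: (near0 _ cw _ (lt_nbhsr wT)).
    by move: nS nw; rewrite !near_withinE; apply: filterS2 => s h1 h2 hs; split;
      [exact: h1|exact: h2].
  have [b badb bTe] := inf_adherent e0 hinf.
  have Tb : T <= b by apply: ge_inf => //; case: hinf.
  have [||Sb wb] := He b.
  - by rewrite /= distrC ger0_norm ?subr_ge0// ltrBlDl.
  - by rewrite in_itv/= andbT (le_trans T0).
  - by case: badb => _ [|]; rewrite leNgt ?Sb ?wb.
have Tgt0 : 0 < T.
  rewrite lt_neqAle T0 andbT; apply/eqP => T00; case: badT => _.
  by rewrite -T00 => -[|]; rewrite leNgt ?S0 ?w0.
have wT : w 0 <= w T.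
  apply: (nondecreasing_of_derive_ge0 w dw) => // u /andP[u0 uT].
  have [Su wu] := goodlt u (ltW u0) uT.
  by apply: dw_ge0 => //; exact: ltW.
(* A strict inequality would already hold slightly before T. *)
have STle : S T <= rho.
  rewrite leNgt; apply/negP => rT.
  have [e /= e0 He] : \forall s \near T, s \in `[0, +oo[ -> rho < S s.
    have : \forall s \near within `[0, +oo[ (nbhs T), rho < S s.
      exact: (near0 _ cS _ (lt_nbhsr rT)).
    by rewrite near_withinE.
  pose s := T - Num.min e T / 2.
  have m0 : 0 < Num.min e T by rewrite lt_min e0.
  have me : Num.min e T <= e by rewrite ge_min lexx.
  have mT : Num.min e T <= T by rewrite ge_min lexx orbT.
  have sT : s < T by rewrite /s; lra.
  have s0 : 0 <= s by rewrite /s; lra.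
  have [+ _] := goodlt s s0 sT.
  rewrite ltNge => /negP; apply; apply/ltW/He => /=.
    by rewrite ger0_norm; rewrite /s; lra.
  by rewrite in_itv/= andbT.
case: badT => _ [rS|]; last by rewrite leNgt (lt_le_trans w0).
have /(w_le0 _ T0) : S T = rho by apply/eqP; rewrite eq_le STle.
by rewrite leNgt (lt_le_trans w0).
Qed.

End real_functions.

(** * Polynomials along curves and on balls *)

Section polynomials.
Context {R : realType} {n : nat}.
Implicit Types (p J : mpoly.mpoly n R) (f : 'I_n -> mpoly.mpoly n R).

(** Evaluation and partial derivatives are computed by rules for constants,
    variables, sums and products; this induction principle matches them, unlike
    the one that splits off a monomial. *)
Lemma mpoly_ring_ind (Q : mpoly.mpoly n R -> Prop) :
  (forall c, Q (mpoly.mpolyC n c)) ->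
  (forall i, Q (mpoly.mpolyX R (mpoly.mnm1 i))) ->
  (forall p q, Q p -> Q q -> Q (p + q)) ->
  (forall p q, Q p -> Q q -> Q (p * q)) ->
  forall p, Q p.
Proof.
move=> QC QX QD QM; elim/mpoly.mpolyind => [|c m p _ _ Qp].
  by rewrite -(mpoly.mpolyC0 n R).
apply: (QD) => //; rewrite -mpoly.mul_mpolyC; apply: (QM) => //.
rewrite mpoly.mpolyXE_id; apply: (big_ind Q) => [|p1 p2|i _]; [|exact: QM|].
  by rewrite -(mpoly.mpolyC1 n R).
elim: (mpoly.fun_of_multinom m i) => [|k IH].
  by rewrite expr0 -(mpoly.mpolyC1 n R).
by rewrite exprS; exact: QM.
Qed.

Lemma peval_sos_ge0 p x : is_sos p -> 0 <= peval p x.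
Proof.
move=> [qs ->]; rewrite /peval rmorph_sum /=.
by apply: sumr_ge0 => q _; rewrite rmorphXn /= sqr_ge0.
Qed.

Lemma peval_sqnorm x : peval (sqnorm_poly R n) x = norm2 x ^+ 2.
Proof.
rewrite /norm2 sqr_sqrtr; last by apply: sumr_ge0 => i _; exact: sqr_ge0.
rewrite /peval /sqnorm_poly rmorph_sum /=; apply: eq_bigr => i _.
by rewrite rmorphXn /= mpoly.mevalXU.
Qed.

Lemma coord_le_norm2 (x : 'rV[R]_n) i : `|x ord0 i| <= norm2 x.
Proof.
rewrite -sqrtr_sqr; apply: ler_wsqrtr.
by rewrite (bigD1 i) //= lerDl; apply: sumr_ge0 => j _; exact: sqr_ge0.
Qed.

(** Bounds on the coordinates propagate through sums and products. *)
Lemma peval_bounded_ball p (r : R) :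
  exists M, forall x, norm2 x <= r -> `|peval p x| <= M.
Proof.
rewrite /peval; elim/mpoly_ring_ind: p => [c|i|p q [M HM] [N HN]|p q [M HM] [N HN]].
- by exists `|c| => x _; rewrite mpoly.mevalC.
- by exists r => x; rewrite mpoly.mevalXU; apply: le_trans; exact: coord_le_norm2.
- exists (M + N) => x xr; rewrite mpoly.mevalD.
  by apply: le_trans (ler_normD _ _) _; apply: lerD; [exact: HM|exact: HN].
- exists (M * N) => x xr; rewrite mpoly.mevalM normrM.
  by apply: ler_pM => //; [exact: HM|exact: HN].
Qed.

Lemma cvg_peval (T : Type) (F : set_system T) {FF : Filter F} p
    (y : T -> 'rV[R]_n) (x : 'rV[R]_n) :
  (forall i, y t ord0 i @[t --> F] --> x ord0 i) ->
  peval p (y t) @[t --> F] --> peval p x.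
Proof.
move=> yx; rewrite /peval; elim/mpoly_ring_ind: p => [c|i|p q Hp Hq|p q Hp Hq].
- by rewrite (eq_fun (fun t => mpoly.mevalC _ c)); rewrite mpoly.mevalC; exact: cvg_cst.
- by rewrite (eq_fun (fun t => mpoly.mevalXU _ i)); rewrite mpoly.mevalXU.
- rewrite (eq_fun (fun s => mpoly.mevalD _ p q)).
  by rewrite mpoly.mevalD; exact: cvgD.
- rewrite (eq_fun (fun s => mpoly.mevalM _ p q)).
  by rewrite mpoly.mevalM; exact: cvgM.
Qed.

(** The chain rule, in a form that only sees the coordinates of the curve. *)
Lemma is_derive_peval p (y : R -> 'rV[R]_n) (v : 'rV[R]_n) (t : R) :
  (forall i, is_derive t 1 (fun s => y s ord0 i) (v ord0 i)) ->
  is_derive t 1 (fun s => peval p (y s))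
    (\sum_(i < n) peval (mpoly.mderiv i p) (y t) * v ord0 i).
Proof.
move=> dy; rewrite /peval; elim/mpoly_ring_ind: p => [c|j|p q Hp Hq|p q Hp Hq].
- rewrite (eq_fun (fun s => mpoly.mevalC _ c)).
  rewrite big1 => [|i _]; first exact: is_derive_cst.
  by rewrite mpoly.mderivC mpoly.meval0 mul0r.
- rewrite (eq_fun (fun s => mpoly.mevalXU _ j)).
  rewrite (bigD1 j) //= big1 ?addr0 => [|i ij].
    apply: (is_derive_eq (dy j)).
    rewrite mpoly.mderivX mpoly.mnm1E eqxx mpoly.mevalZ.
    rewrite (_ : mpoly.mnm_sub _ _ = mpoly.mnm0) ?mpoly.mpolyX0 ?mpoly.meval1 ?mul1r//.
    by apply/mpoly.mnmP => k; rewrite mpoly.mnmBE subnn mpoly.mnm0E.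
  by rewrite mpoly.mderivX mpoly.mnm1E eq_sym (negbTE ij) mpoly.mevalZ !mul0r.
- rewrite (eq_fun (fun s => mpoly.mevalD _ p q)).
  apply: (is_derive_eq (is_deriveD Hp Hq)).
  rewrite -big_split /=; apply: eq_bigr => i _.
  by rewrite mpoly.mderivD mpoly.mevalD mulrDl.
- rewrite (eq_fun (fun s => mpoly.mevalM _ p q)).
  apply: (is_derive_eq (is_deriveM Hp Hq)).
  rewrite !scaler_sumr -big_split /=; apply: eq_bigr => i _.
  rewrite mpoly.mderivM mpoly.mevalD !mpoly.mevalM /GRing.scale /=.
  by ring.
Qed.

(** * Pointwise content of the sum-of-squares constraints *)

Lemma peval_lie_derivative J f x : peval (lie_derivative J f) x =
  \sum_(i < n) peval (mpoly.mderiv i J) x * vector_field f x ord0 i.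
Proof.
rewrite /peval /lie_derivative rmorph_sum /=; apply: eq_bigr => i _.
by rewrite mpoly.mevalM mxE.
Qed.

(** The first constraint equates k1 with the difference of the two sides, minus
    s * (r^2 - |x|^2); k1 and s are nonnegative, being sums of squares, and the
    multiplier of s is nonnegative exactly on the ball. *)
Lemma sos_feasible_lie f lambda beta r d J x : sos_feasible f lambda beta r d J ->
  norm2 x ^+ 2 <= r ^+ 2 ->
  lambda * (peval (1 - J) x * norm2 x ^+ 2 ^+ beta)
    <= peval (lie_derivative (1 - J) f) x.
Proof.
move=> [_ [k1 [k2 [s [p [[[sk1 _] _ [ss _] _] [_ k1E _]]]]]]] xr.
have := peval_sos_ge0 k1 x sk1; have := peval_sos_ge0 s x ss.
have -> : lie_derivative (1 - J) f = - lie_derivative J f.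
  rewrite /lie_derivative -sumrN; apply: eq_bigr => i _.
  by rewrite mpoly.mderivB -(mpoly.mpolyC1 n R) mpoly.mderivC sub0r mulNr.
rewrite k1E -peval_sqnorm /peval !(mpoly.mevalB, mpoly.mevalN, mpoly.mevalM,
  mpoly.mevalZ, mpoly.mevalC) rmorphXn /= -!/(peval _ _) peval_sqnorm.
nra.
Qed.

(** On the sphere the multiplier p, of unknown sign, disappears from the second
    constraint. *)
Lemma sos_feasible_sphere f lambda beta r d J x : sos_feasible f lambda beta r d J ->
  norm2 x ^+ 2 = r ^+ 2 -> peval (1 - J) x <= 0.
Proof.
move=> [_ [k1 [k2 [s [p [[_ [sk2 _] _ _] [_ _ k2E]]]]]]] xr.
have := peval_sos_ge0 k2 x sk2.
rewrite k2E /peval !(mpoly.mevalB, mpoly.mevalM, mpoly.mevalC, mpoly.meval1).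
by rewrite -!/(peval _ _) peval_sqnorm xr subrr mulr0 subr0 !subr_ge0 subr_le0.
Qed.

End polynomials.

(** * Solutions of the differential equation *)

Section trajectories.
Context {R : realType} {n : nat}.
Implicit Types (f : 'I_n -> mpoly.mpoly n R) (y : R -> 'rV[R]_n).

(** At a positive time the constraint t + h >= 0 in the difference quotient
    holds for all small h, so the derivative is two-sided. *)
Lemma is_derive_ode_coord f y (t : R) i : ode_solution f y -> 0 < t ->
  is_derive t 1 (fun s => y s ord0 i) (vector_field f (y t) ord0 i).
Proof.
move=> ode t0.
have H : h^-1 *: (y (t + h) - y t) @[h --> 0^'] --> vector_field f (y t).
  have pos : \forall h \near (0 : R)^', 0 <= t + h.
    rewrite near_withinE; apply/nbhs_ballP; exists t => //= h.
    rewrite /ball/= sub0r normrN => ht _; have := ler_norm (- h).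
    by rewrite normrN; lra.
  by move=> U /(ode t (ltW t0)) HU; apply: filterS2 pos HU => h h1 h2; exact: h2 h1.
have {}H : h^-1 *: (y (h *: 1 + t) ord0 i - y t ord0 i) @[h --> 0^'] -->
    vector_field f (y t) ord0 i.
  have := cvg_comp _ _ H (@coord_continuous _ _ _ ord0 i _).
  apply: cvg_trans; apply: near_eq_cvg; near=> h.
  by rewrite /= !mxE (addrC t) -[X in y (X + t)](mulr1 h).
by split; [exact: cvgP H|exact: cvg_lim H].
Unshelve. all: by end_near.
Qed.

(** At time 0 right-continuity comes from the one-sided difference quotient:
    y(h) = y(0) + h * (quotient) and the quotient converges. *)
Lemma within_continuous_ode f y p : ode_solution f y ->
  {within `[0, +oo[, continuous (fun t => peval p (y t))}.
Proof.
move=> ode; apply/subspace_continuousP => t t0; apply: cvg_peval => i.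
move: t t0; apply/subspace_continuousP/continuous_within_itvcyP; split.
  move=> t; rewrite in_itv/= andbT => t0.
  apply/differentiable_continuous/derivable1_diffP.
  by have [] := is_derive_ode_coord f y t i ode t0.
have H : h^-1 *: (y (0 + h) - y 0) @[h --> 0^'+] --> vector_field f (y 0).
  move=> U /(ode 0 (lexx 0)) HU.
  have {}HU : \forall h \near (0 : R),
      h != 0 -> 0 <= 0 + h -> U (h^-1 *: (y (0 + h) - y 0)) := HU.
  have : \forall h \near (0 : R), 0 < h -> U (h^-1 *: (y (0 + h) - y 0)).
    by apply: filterS HU => h hU h0; apply: hU; rewrite ?gt_eqF ?add0r ?ltW.
  exact.
have {}H : h^-1 * (y (0 + h) ord0 i - y 0 ord0 i) @[h --> 0^'+] -->
    vector_field f (y 0) ord0 i.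
  have := cvg_comp _ _ H (@coord_continuous _ _ _ ord0 i _).
  by apply: cvg_trans; apply: near_eq_cvg; near=> h; rewrite /= !mxE.
have id0 : (h : R) @[h --> 0^'+] --> (0 : R) by exact: cvg_at_right_filter.
have {}H : h * (h^-1 * (y (0 + h) ord0 i - y 0 ord0 i)) + y 0 ord0 i
    @[h --> 0^'+] --> 0 * vector_field f (y 0) ord0 i + y 0 ord0 i.
  by apply: cvgD; [exact: cvgM|exact: cvg_cst].
rewrite mul0r add0r in H.
apply: cvg_trans H; apply: near_eq_cvg; near=> h.
by rewrite add0r mulrA mulfV ?mul1r ?subrK// gt_eqF.
Unshelve. all: by end_near.
Qed.

Lemma is_derive_ode f y p (t : R) : ode_solution f y -> 0 < t ->
  is_derive t 1 (fun s => peval p (y s)) (peval (lie_derivative p f) (y t)).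
Proof.
move=> ode t0; rewrite peval_lie_derivative; apply: is_derive_peval => i.
exact: is_derive_ode_coord.
Qed.

End trajectories.

(** From the time T of entry on, the exponential decay estimate applies to the
    trajectory restarted at its position at time T. *)
Lemma ROA_of_enter_stable (R : realType) (n : nat)
    (phi : 'rV[R]_n -> R -> 'rV[R]_n) (U : set 'rV[R]_n) x (T : R) :
  exponentially_stable_set phi U ->
  (forall t : R, 0 <= t -> phi (phi x T) t = phi x (T + t)) ->
  U (phi x T) -> ROA phi x.
Proof.
move=> [_ [delta [mu [delta0 mu0 stab]]]] phiD /stab[_ _ decay].
have exp0 : expR (- delta * (t - T)) @[t --> +oo] --> (0 : R).
  under eq_fun do rewrite mulNr.
  apply: (cvg_comp _ _ _ (@cvgr_expR R)); apply: gt0_cvgMry => //.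
  exact: cvg_addrr.
have bound0 : mu * expR (- delta * (t - T)) * norm2 (phi x T) @[t --> +oo]
    --> mu * 0 * norm2 (phi x T).
  by apply: cvgM; [apply: cvgM; [exact: cvg_cst|exact: exp0]|exact: cvg_cst].
rewrite mulr0 mul0r in bound0.
apply: squeeze_cvgr (cvg_cst 0) bound0; near=> t.
have tT : 0 <= t - T.
  by rewrite subr_ge0; near: t; apply: nbhs_pinfty_ge; exact: num_real.
rewrite sqrtr_ge0 /=; have := decay _ tT.
by rewrite phiD// (addrC T) subrK.
Unshelve. all: by end_near.
Qed.

Theorem corollary3 (R : realType) (n : nat)
    (f : 'I_n -> mpoly.mpoly n R) (phi : 'rV[R]_n -> R -> 'rV[R]_n)
    (f0 : vector_field f 0 = 0) (phi_sol : solution_map f phi)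
    (lambda : R) (beta : nat) (r : R) (Lambda : set 'rV[R]_n)
    (lambda_gt0 : 0 < lambda) (beta_gt0 : (0 < beta)%N) (r_gt0 : 0 < r)
    (roa_bounded : ROA phi `<=` ball2 0 r)
    (stable : exists eta : R,
      0 < eta /\ exponentially_stable_set phi (ball2 0 eta)) :
  forall d : nat, (0 < d)%N ->
  forall P : mpoly.mpoly n R, sos_minimizer f lambda beta r Lambda d P ->
    ball2 0 r `&` [set x | peval P x < 1] `<=` ROA phi.
Proof.
move=> d _ P [feas _] x [xr Px1].
have [eta [eta0 stab]] := stable; have [sol phi0 phiD _] := phi_sol.
have ball2E z s : ball2 0 s z = (norm2 z < s) by rewrite /ball2/= subr0.
rewrite ball2E in xr.
pose w (t : R) := peval (1 - P) (phi x t).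
pose S (t : R) := norm2 (phi x t) ^+ 2.
pose dw (t : R) := peval (lie_derivative (1 - P) f) (phi x t).
have SE : S = fun t : R => peval (sqnorm_poly R n) (phi x t).
  by apply/funext => t; rewrite peval_sqnorm.
have norm2_ge0 z : 0 <= norm2 z :> R by exact: sqrtr_ge0.
have w0 : 0 < w 0.
  by rewrite /w phi0 /peval mpoly.mevalB mpoly.meval1 subr_gt0.
have cw : {within `[0, +oo[, continuous w} by exact: (within_continuous_ode f).
have dwE (t : R) : 0 < t -> is_derive t 1 w (dw t) by exact: is_derive_ode.
have cS : {within `[0, +oo[, continuous S}.
  by rewrite SE; exact: (within_continuous_ode f).
have dw_ge0 (t : R) : 0 < t -> S t <= r ^+ 2 -> 0 <= w t -> 0 <= dw t.
  move=> _ St wt; apply: le_trans (sos_feasible_lie _ _ _ _ _ _ _ feas St).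
  by rewrite mulr_ge0 ?(ltW lambda_gt0)// mulr_ge0// exprn_ge0// sqr_ge0.
have w_le0 (t : R) : 0 <= t -> S t = r ^+ 2 -> w t <= 0.
  by move=> _; exact: (sos_feasible_sphere _ _ _ _ _ _ _ feas).
have S0 : S 0 < r ^+ 2 by rewrite /S phi0 ltr_pXn2r// nnegrE ?norm2_ge0 ?(ltW r_gt0).
(* The trajectory stays in the open ball and w never drops below w 0. *)
have inv := first_exit_barrier w S dw (r ^+ 2) cw cS dwE dw_ge0 w_le0 w0 S0.
have [M HM] := peval_bounded_ball (1 - P) r.
have [[T [T0 enter]]|far] := pselect (exists T : R, 0 <= T /\ norm2 (phi x T) < eta).
  apply: (ROA_of_enter_stable _ _ _ _ _ T stab).
    by move=> t t0; exact: phiD.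
  by rewrite ball2E.
have {}far (t : R) : 0 <= t -> eta <= norm2 (phi x t).
  by move=> t0; rewrite leNgt; apply/negP => h; apply: far; exists t.
(* Far from the origin, w grows at least at the constant rate c. *)
pose c := lambda * (w 0 * eta ^+ 2 ^+ beta).
have c0 : 0 < c by rewrite /c !mulr_gt0// !exprn_gt0.
have growth (T : R) : 0 <= T -> c * T <= w T - w 0.
  move=> T0; rewrite -{1}(subr0 T); apply: (@le_of_derive_ge _ w dw) => // t.
  move=> /andP[t0 _]; have [St wt] := inv t (ltW t0).
  apply: le_trans (sos_feasible_lie _ _ _ _ _ _ _ feas (ltW St)).
  apply: ler_wpM2l; first exact: ltW.
  have eta_far : eta ^+ 2 <= norm2 (phi x t) ^+ 2.
    by rewrite lerXn2r ?nnegrE ?norm2_ge0 ?(ltW eta0) ?far ?(ltW t0).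
  apply: ler_pM => //; [exact: ltW|by rewrite exprn_ge0 ?sqr_ge0|].
  by rewrite lerXn2r ?nnegrE ?sqr_ge0.
(* By time M / c the growth exceeds M: this contradicts w <= M, as w 0 > 0. *)
have M0 : 0 <= M.
  by apply: le_trans (HM x (ltW xr)).
have := growth (M / c) (divr_ge0 M0 (ltW c0)).
rewrite mulrC divfK ?gt_eqF// => MwT.
have [ST _] := inv (M / c) (divr_ge0 M0 (ltW c0)).
have : w (M / c) <= M.
  apply: le_trans (ler_norm _) (HM _ _).
  by move: ST; rewrite /S ltr_pXn2r ?nnegrE ?(ltW r_gt0)//; exact: ltW.
by lra.
Qed.
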